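(* Let $A$ be an invertible symmetric complex $n\times n$ matrix and $P(z)\in\mathcal{A}_n$ a homogeneous $\Delta_A$-nilpotent polynomial of degree $d\ge3$. Then, for any $m\ge1$, $\Delta_A^mP^{m+1}$ is isotropic with respect to the $\mathbb{C}$-bilinear form $(\cdot,\cdot)_A$, i.e. $$(\Delta_A^mP^{m+1},\Delta_A^mP^{m+1})_A=0.$$ In particular, $(P,P)_A=0$.
   Context: $\mathcal{A}_n=\mathbb{C}[z_1,\dots,z_n]$, $D=(D_1,\dots,D_n)$ with $D_i=\partial/\partial z_i$, $\Delta_A=\sum_{i,j=1}^n a_{ij}D_iD_j$ for $A=(a_{ij})$. $P$ is $\Delta_A$-nilpotent if $\Delta_A^m(P^m)=0$ for all $m\ge1$. The symmetric $\mathbb{C}$-bilinear form $(\cdot,\cdot)_A:\mathcal{A}_n\times\mathcal{A}_n\to\mathbb{C}$ is $(f,g)_A:=\left(f(AD)g(z)\right)|_{z=0}$, where $f(AD)$ is the constant coefficient differential operator obtained by substituting $\sum_j a_{ij}D_j$ for $z_i$ in $f$. $\Delta_A^mP^{m+1}$ means $\Delta_A^m$ applied to $P^{m+1}$. *)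

(* Defs.v *)
From HB Require Import structures.
From mathcomp Require Import all_boot all_order all_algebra.
From mathcomp Require Import reals.
From mathcomp Require Import complex.
From mathcomp Require Import mpoly.

Set Implicit Arguments.
Unset Strict Implicit.
Unset Printing Implicit Defensive.

Import GRing.Theory.

Local Open Scope ring_scope.

Section LaplaceOperators.

Variables (K : comNzRingType) (n : nat).
Implicit Types (A : 'M[K]_n) (f g P : {mpoly K[n]}).

Definition laplace A P : {mpoly K[n]} :=
  \sum_(i < n) \sum_(j < n) A i j *: P^`M(j)^`M(i).

Definition laplace_nilpotent A P : Prop :=
  forall m : nat, (0 < m)%N -> iter m (laplace A) (P ^+ m) = 0.

(* f(D) g, where f(D) is obtained by substituting D_i for z_i in f *)
Definition diffop f g : {mpoly K[n]} :=
  \sum_(m <- msupp f) f@_m *: g^`M[m].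

(* f(Az), i.e. f with \sum_j a_ij z_j substituted for z_i *)
Definition subst_mx A f : {mpoly K[n]} :=
  f \mPo [tuple \sum_(j < n) A i j *: 'X_j | i < n].

(* (f, g)_A = (f(AD) g)(0); the symbol of the operator f(AD) is f(Az) *)
Definition diff_form A f g : K :=
  (diffop (subst_mx A f) g).@[fun=> 0].

End LaplaceOperators.

(* Main.v *)
(** Put [Q = \sum_i q_i t^i] with [q_i = L^i P^(i+1) / (2^i i! (i+1)!)], where [L]
is the Laplacian and [<u, v>] the associated bilinear form on gradients.
Nilpotency makes every [q_i] harmonic, hence
[L (Q^(k+2)) = (k+2)(k+1) Q^k <Q, Q>].  By induction on the power of [t] this
gives the inviscid Burgers equation [2 Q' = <Q, Q>] together with
[Q^k = \sum_j k! / (2^j j! (k+j)!) L^j P^(k+j) t^j] for [k >= 1].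
For [k = 2] nilpotency yields [L^2 (Q^2) = 0], and so [L^N (Q^2) = 0] for
[N = deg q_m].  In the coefficient of [t^(2m)], a product [q_i q_(2m-i)] with
[i <> m] has a harmonic factor of degree less than [N] and is killed by [L^N],
while [L^N (q_m^2)] evaluates at [0] to [2^N N! (q_m, q_m)_A]. *)

Require Import Defs.
From HB Require Import structures.
From mathcomp Require Import all_boot all_order all_algebra.
From mathcomp Require Import reals.
From mathcomp Require Import complex.
From mathcomp Require Import mpoly.
From mathcomp Require Import bigenough ssrcomplements zify ring.

Set Implicit Arguments.
Unset Strict Implicit.
Unset Printing Implicit Defensive.

Import GRing.Theory Num.Theory BigEnough.

Local Open Scope ring_scope.

(** * Second-order operators built from derivations of a commutative ring *)

Section SecondOrderOperator.

Variables (B : comNzRingType) (n : nat).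
Variables (a : 'I_n -> 'I_n -> B) (D : 'I_n -> {additive B -> B}).
Hypothesis a_sym : forall i j, a i j = a j i.
Hypothesis D_mul : forall i x y, D i (x * y) = D i x * y + x * D i y.

(** The ring is abstract because two are needed: polynomials, and polynomials in [t] over them with
    coefficientwise derivations. *)
Definition lapl x := \sum_i \sum_j a i j * D i (D j x).
Definition grad2 x y := \sum_i \sum_j a i j * (D i x * D j y).

Lemma grad2C x y : grad2 x y = grad2 y x.
Proof.
rewrite /grad2 exchange_big; apply: eq_bigr => i _; apply: eq_bigr => j _.
by rewrite a_sym [D j x * _]mulrC.
Qed.

Lemma grad2Mr x y z : grad2 x (y * z) = grad2 x y * z + y * grad2 x z.
Proof.
rewrite /grad2 mulr_suml mulr_sumr -big_split; apply: eq_bigr => i _ /=.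
rewrite mulr_suml mulr_sumr -big_split; apply: eq_bigr => j _ /=.
by rewrite D_mul; ring.
Qed.

Lemma laplM x y : lapl (x * y) = lapl x * y + x * lapl y + grad2 x y *+ 2.
Proof.
(* The cross terms are [D i x * D j y] and [D j x * D i y]; swapping one copy of [grad2] matches
   them termwise. *)
rewrite mulr2n {2}grad2C /lapl /grad2 mulr_suml mulr_sumr -!big_split /=.
apply: eq_bigr => i _; rewrite mulr_suml mulr_sumr -!big_split /=.
apply: eq_bigr => j _; rewrite D_mul raddfD /= !D_mul; ring.
Qed.

Lemma grad2X x k : grad2 x (x ^+ k.+1) = x ^+ k * grad2 x x *+ k.+1.
Proof.
elim: k => [|k IHk]; first by rewrite expr1 expr0 mul1r.
by rewrite exprS grad2Mr IHk exprS -mulrnAl -mulrnAr; ring.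
Qed.

Lemma laplX x k : lapl x = 0 ->
  lapl (x ^+ k.+2) = x ^+ k * grad2 x x *+ (k.+2 * k.+1).
Proof.
move=> x0; elim: k => [|k IHk].
  by rewrite expr2 laplM x0 mul0r mulr0 !add0r expr0 mul1r.
rewrite exprS laplM x0 IHk grad2X mul0r add0r.
rewrite -mulrnA -mulrnAr mulrA -exprS mulrnAr -mulrnDr; congr (_ *+ _); lia.
Qed.

End SecondOrderOperator.

(** * Iterated Laplacians of a product of two harmonic polynomials *)

Section Laplace.

Variables (K : comNzRingType) (n : nat) (A : 'M[K]_n).
Implicit Types (f g P : {mpoly K[n]}).

Lemma laplace_is_linear : linear (@laplace K n A).
Proof.
move=> c f g; rewrite /laplace scaler_sumr -big_split; apply: eq_bigr => i _ /=.
rewrite scaler_sumr -big_split; apply: eq_bigr => j _ /=.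
by rewrite !(mderivD, mderivZ) scalerDr !scalerA [c * _]mulrC.
Qed.

HB.instance Definition _ := GRing.isLinear.Build K {mpoly K[n]} {mpoly K[n]}
  _ (@laplace K n A) laplace_is_linear.

Lemma iter_laplaceZ k c f :
  iter k (laplace A) (c *: f) = c *: iter k (laplace A) f.
Proof. by elim: k => //= k ->; rewrite linearZ. Qed.

Lemma iter_laplace_sum k (I : Type) (r : seq I) (F : I -> {mpoly K[n]}) :
  iter k (laplace A) (\sum_(i <- r) F i) =
  \sum_(i <- r) iter k (laplace A) (F i).
Proof. by elim: k => //= k ->; rewrite raddf_sum. Qed.

Lemma iter_laplace0 k : iter k (laplace A) 0 = 0.
Proof. by elim: k => //= k ->; rewrite raddf0. Qed.

Lemma laplaceE f :
  laplace A f = lapl (fun i j => (A i j)%:MP) (@mderiv n K) f.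
Proof.
by apply: eq_bigr => i _; apply: eq_bigr => j _; rewrite mul_mpolyC.
Qed.

Lemma laplace_harmonicM f g : A^T = A -> laplace A f = 0 -> laplace A g = 0 ->
  laplace A (f * g) =
  (\sum_(i < n) \sum_(j < n) A i j *: (f^`M(i) * g^`M(j))) *+ 2.
Proof.
move=> A_sym; rewrite !laplaceE => f0 g0; rewrite laplM; first last.
- exact: mderivM.
- by move=> i j; rewrite -{1}A_sym mxE.
rewrite f0 g0 mul0r mulr0 !add0r; congr (_ *+ 2).
by apply: eq_bigr => i _; apply: eq_bigr => j _; rewrite mul_mpolyC.
Qed.

Lemma mderiv_laplace i f : (laplace A f)^`M(i) = laplace A f^`M(i).
Proof.
rewrite raddf_sum; apply: eq_bigr => j _ /=.
rewrite raddf_sum; apply: eq_bigr => k _ /=.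
by rewrite mderivZ (mderiv_comm j) (mderiv_comm k).
Qed.

(** Truncation at [d = 0] is harmless: the derivative is then 0, homogeneous of every degree. *)
Lemma mderiv_dhomog d i f : f \is d.-homog -> f^`M(i) \is d.-1.-homog.
Proof.
move=> /dhomogP f_homog; apply/dhomogP => m; rewrite mcoeff_msupp mcoeff_mderiv.
move=> nz; have /f_homog : (m + U_(i))%MM \in msupp f.
  by rewrite mcoeff_msupp; apply: contraNneq nz => ->; rewrite mul0rn.
by rewrite /= mdegD mdeg1 => <-; rewrite addn1.
Qed.

Lemma mderiv_0homog i f : f \is 0.-homog -> f^`M(i) = 0.
Proof.
move=> /dhomogP f_homog; apply/mpolyP => m; rewrite mcoeff_mderiv mcoeff0.
have [/f_homog|/memN_msupp_eq0->] := boolP ((m + U_(i))%MM \in msupp f).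
  by rewrite /= mdegD mdeg1 addn1.
by rewrite mul0rn.
Qed.

Lemma laplace_dhomog d f : f \is d.-homog -> laplace A f \is (d - 2).-homog.
Proof.
move=> f_homog; apply: rpred_sum => i _; apply: rpred_sum => j _.
by apply: rpredZ; rewrite subn2; do 2 apply: mderiv_dhomog.
Qed.

Lemma iter_laplace_dhomog k d f :
  f \is d.-homog -> iter k (laplace A) f \is (d - k.*2).-homog.
Proof.
move=> f_homog; elim: k => [|k IHk]; first by rewrite subn0.
by rewrite doubleS -addn2 subnDA; apply: laplace_dhomog.
Qed.

(** The [k]-th derivative tensors of [f] and [g] paired through [k] copies of [A]; this links the
    product ([k = 0]) to the form. *)
Fixpoint contraction k f g : {mpoly K[n]} :=
  if k is k'.+1 then
    \sum_(i < n) \sum_(j < n) A i j *: contraction k' f^`M(i) g^`M(j)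
  else f * g.

Lemma contraction0l k g : contraction k 0 g = 0.
Proof.
elim: k g => [|k IHk] g /=; first by rewrite mul0r.
by rewrite big1 // => i _; rewrite big1 // => j _; rewrite raddf0 IHk scaler0.
Qed.

Lemma contraction_dhomog k d f g :
  (d < k)%N -> f \is d.-homog -> contraction k f g = 0.
Proof.
elim: k d f g => // k IHk [|d] f g ltdk f_homog /=.
  rewrite big1 // => i _; rewrite big1 // => j _.
  by rewrite mderiv_0homog // contraction0l scaler0.
rewrite big1 // => i _; rewrite big1 // => j _.
by rewrite (IHk d) ?scaler0 // (mderiv_dhomog _ f_homog).
Qed.

(** Partial derivatives commute with the Laplacian, so they preserve harmonicity and only the cross
    terms survive. *)
Lemma laplace_contraction k f g : A^T = A ->
    laplace A f = 0 -> laplace A g = 0 ->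
  laplace A (contraction k f g) = contraction k.+1 f g *+ 2.
Proof.
move=> A_sym; elim: k f g => [|k IHk] f g f0 g0.
  exact: laplace_harmonicM.
rewrite /= raddf_sum -sumrMnl; apply: eq_bigr => i _ /=.
rewrite raddf_sum -sumrMnl; apply: eq_bigr => j _ /=.
by rewrite linearZ /= IHk -?mderiv_laplace ?f0 ?g0 ?raddf0 // scalerMnr.
Qed.

Lemma iter_laplace_harmonicM k f g : A^T = A ->
    laplace A f = 0 -> laplace A g = 0 ->
  iter k (laplace A) (f * g) = contraction k f g *+ 2 ^ k.
Proof.
move=> A_sym f0 g0; elim: k => // k IHk.
by rewrite iterS IHk raddfMn /= laplace_contraction // -mulrnA expnS.
Qed.

(** Each Laplacian differentiates both harmonic factors once, and more than [d] derivatives kill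
    [f]. *)
Lemma iter_laplace_harmonicM_eq0 k d f g : A^T = A ->
    laplace A f = 0 -> laplace A g = 0 -> f \is d.-homog -> (d < k)%N ->
  iter k (laplace A) (f * g) = 0.
Proof.
move=> A_sym f0 g0 f_homog ltdk.
by rewrite iter_laplace_harmonicM // (contraction_dhomog _ ltdk) // mul0rn.
Qed.

End Laplace.

(** * The bilinear form as a full contraction *)

Section DiffForm.

Variables (K : comNzRingType) (n : nat) (A : 'M[K]_n).
Implicit Types (f g h : {mpoly K[n]}).

(** An index set independent of the support of [f] makes linearity in [f] a termwise check. *)
Lemma diffopwE k f g : (msize f <= k)%N ->
  diffop f g = \sum_(m : 'X_{1..n < k}) f@_m *: g^`M[m].
Proof.
pose I : subFinType _ := 'X_{1..n < k}.
move=> le_fk; rewrite /diffop (big_mksub I) /=; first last.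
- by move=> x /msize_mdeg_lt/leq_trans/(_ le_fk).
- by rewrite msupp_uniq.
rewrite big_rmcond //= => j /memN_msupp_eq0 ->.
by rewrite scale0r.
Qed.

Lemma diffopD f h g : diffop (f + h) g = diffop f g + diffop h g.
Proof.
pose_big_enough k; first rewrite !(@diffopwE k) //.
  rewrite -big_split; apply: eq_bigr => m _.
  by rewrite mcoeffD scalerDl.
by close.
Qed.

Lemma diffopZ c f g : diffop (c *: f) g = c *: diffop f g.
Proof.
pose_big_enough k; first rewrite !(@diffopwE k) //.
  rewrite scaler_sumr; apply: eq_bigr => m _.
  by rewrite mcoeffZ scalerA.
by close.
Qed.

Lemma diffop0 g : diffop 0 g = 0.
Proof. by rewrite /diffop msupp0 big_nil. Qed.

Lemma diffop_sum (I : Type) (r : seq I) (F : I -> {mpoly K[n]}) g :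
  diffop (\sum_(i <- r) F i) g = \sum_(i <- r) diffop (F i) g.
Proof.
exact: (big_morph (fun f => diffop f g) (fun f h => diffopD f h g) (diffop0 g)).
Qed.

Lemma diffopXm m g : diffop 'X_[m] g = g^`M[m].
Proof. by rewrite /diffop msuppX big_seq1 mcoeffX eqxx scale1r. Qed.

Lemma diffopC c g : diffop c%:MP g = c *: g.
Proof. by rewrite -alg_mpolyC -mpolyX0 diffopZ diffopXm mderivm0m. Qed.

Lemma diffopMX i f g : diffop ('X_i * f) g = diffop f g^`M(i).
Proof.
elim/mpolyind: f => [|c m f _ _ IHf]; first by rewrite mulr0 !diffop0.
rewrite mulrDr !diffopD IHf -scalerAr !diffopZ -mpolyXD !diffopXm.
by rewrite mderivmDm mderivmU1m.
Qed.

Lemma euler_dhomog d f : f \is d.-homog ->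
  \sum_(i < n) 'X_i * f^`M(i) = f *+ d.
Proof.
move=> /dhomogP f_homog; rewrite [in RHS](mpolyE f) -sumrMnl.
under eq_bigr => i _ do rewrite /mderiv mulr_sumr.
rewrite exchange_big /= !big_seq; apply: eq_bigr => m /f_homog /= <-.
rewrite mdegE -sumrMnr; apply: eq_bigr => i _.
rewrite -scalerAr -mpolyXD -scalerA scaler_nat.
(* A zero exponent is treated apart: there [m - U_(i)] truncates, but the coefficient vanishes. *)
have [->|nz_mi] := eqVneq (m i) 0%N; first by rewrite !mulr0n.
rewrite addmC submK ?scalerMnr //.
by apply/mnm_lepP => l; rewrite mnm1E; case: eqP => [<-|//]; rewrite lt0n.
Qed.

(** Euler's identity splits a factor ['X_i] off [f]; substitution turns it into the derivation
    [\sum_j A i j D_j] acting on [g]. *)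
Lemma diff_formS d f g : f \is d.-homog ->
  diff_form A f g *+ d =
  \sum_(i < n) \sum_(j < n) A i j * diff_form A f^`M(i) g^`M(j).
Proof.
move=> f_homog; rewrite /diff_form -raddfMn /=.
have -> : diffop (subst_mx A f) g *+ d = diffop (subst_mx A (f *+ d)) g.
  by rewrite /subst_mx raddfMn /= -!scaler_nat diffopZ.
rewrite -(euler_dhomog f_homog) /subst_mx; set t := mktuple _.
rewrite (raddf_sum (comp_mpoly t)) diffop_sum raddf_sum /=.
apply: eq_bigr => i _; rewrite rmorphM /= comp_mpolyXU.
rewrite -tnth_nth tnth_mktuple mulr_suml diffop_sum raddf_sum /=.
by apply: eq_bigr => j _; rewrite -scalerAl diffopZ diffopMX mevalZ.
Qed.

(** Euler's identity used in degrees [d], ..., 1 produces the factorial. *)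
Lemma contraction_diff_form d f g : f \is d.-homog ->
  (contraction A d f g).@[fun=> 0] = diff_form A f g *+ d`!.
Proof.
elim: d f g => [|d IHd] f g f_homog.
  have -> : f = (f@_0)%:MP.
    apply/mpolyP => m; rewrite mcoeffC; have [->|nz_m] := eqVneq m 0%MM.
      by rewrite mulr1.
    by rewrite mulr0 (dhomog_nemf_coeff f_homog) //= mdeg_eq0.
  by rewrite /= /diff_form /subst_mx comp_mpolyC mul_mpolyC diffopC.
rewrite factS mulrnA (diff_formS _ f_homog) /= -sumrMnl raddf_sum /=.
apply: eq_bigr => i _; rewrite -sumrMnl raddf_sum /=; apply: eq_bigr => j _.
by rewrite mevalZ IHd ?mulrnAr // (mderiv_dhomog _ f_homog).
Qed.

End DiffForm.

(** * The generating function and the coefficients of its powers *)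

Section GeneratingFunction.

Variables (K : numFieldType) (n : nat) (A : 'M[K]_n) (P : {mpoly K[n]}).
Hypotheses (A_sym : A^T = A) (P_nil : laplace_nilpotent A P).

Let B : comNzRingType := {poly {mpoly K[n]}}.
Let a i j : B := (A i j)%:MP%:P.
Let D (i : 'I_n) : {additive B -> B} := map_poly (mderiv i).

Let a_sym i j : a i j = a j i.
Proof. by rewrite /a -{1}A_sym mxE. Qed.

Let D_mul i (x y : B) : D i (x * y) = D i x * y + x * D i y.
Proof.
apply/polyP => k; rewrite coefD !coefM coef_map coefM raddf_sum -big_split /=.
by apply: eq_bigr => j _; rewrite !coef_map mderivM.
Qed.

Lemma coef_lapl (x : B) k : (lapl a D x)`_k = laplace A x`_k.
Proof.
rewrite coef_sum; apply: eq_bigr => i _; rewrite coef_sum; apply: eq_bigr => j _.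
by rewrite coefCM !coef_map mul_mpolyC.
Qed.

Definition lpow k j : {mpoly K[n]} := iter j (laplace A) (P ^+ (k + j)).

(** Normalised to be 1 at [j = 0] and to satisfy the recursion [lpow_coefS], which the Burgers
    equation imposes. *)
Definition lpow_coef k j : K :=
  k`!%:R / (2 ^+ j * j`!%:R * (k + j)`!%:R).

Lemma lpow_coef_neq0 k j : lpow_coef k j != 0.
Proof.
have fnz m : m`!%:R != 0 :> K by rewrite pnatr_eq0 -lt0n fact_gt0.
by rewrite mulf_neq0 // invr_eq0 !mulf_neq0 // expf_neq0 // pnatr_eq0.
Qed.

Lemma lpow_coefS k j :
  lpow_coef k j.+1 *+ (2 * j.+1 * k.+1) = lpow_coef k.+1 j.
Proof.
rewrite /lpow_coef addnS addSn !factS -mulr_natr !natrM exprS.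
have nz m : m.+1%:R != 0 :> K by rewrite pnatr_eq0.
have fnz m : m`!%:R != 0 :> K by rewrite pnatr_eq0 -lt0n fact_gt0.
have xnz : 2 ^+ j != 0 :> K by rewrite expf_neq0 // pnatr_eq0.
by field; rewrite -natrD !nat1r !nz !fnz xnz.
Qed.

Lemma laplace_lpow k j : laplace A (lpow k.+1 j) = lpow k j.+1.
Proof. by rewrite /lpow addSnnS. Qed.

Lemma lpow0 j : lpow 0 j.+1 = 0.
Proof. exact: P_nil. Qed.

(** The series [Q] truncated at order [M]; only coefficients below [M] are meaningful in its
    powers. *)
Definition lpow_series M : B := \poly_(i < M) (lpow_coef 1 i *: lpow 1 i).

Lemma lapl_lpow_series M : lapl a D (lpow_series M) = 0.
Proof.
apply/polyP => j; rewrite coef_lapl coef_poly coef0.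
case: ifP => _; last by rewrite raddf0.
by rewrite linearZ /= laplace_lpow lpow0 scaler0.
Qed.

(** The induction keeps [k] general: order [j.+1] of [Q ^+ k.+1] is obtained from order [j] of the
    Laplacian of [Q ^+ k.+2]. *)
Lemma coef_lpow_seriesX M k j : (j < M)%N ->
  (lpow_series M ^+ k.+1)`_j = lpow_coef k.+1 j *: lpow k.+1 j.
Proof.
set Q := lpow_series M; elim/ltn_ind: j k => -[_ k M_gt0|j IHj k ltjM].
  have coef0X (p : B) m : (p ^+ m)`_0 = p`_0 ^+ m.
    by elim: m => [|m IHm]; rewrite ?coef1 // !exprS coef0M IHm.
  rewrite coef0X coef_poly M_gt0 /lpow /lpow_coef /= !addn0 !mul1r.
  by rewrite divff ?pnatr_eq0 -?lt0n ?fact_gt0 // factS fact0 invr1 !scale1r expr1.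
have Q0 : lapl a D Q = 0 by exact: lapl_lpow_series.
have mulIrn (p q : {mpoly K[n]}) m : p *+ m.+1 = q *+ m.+1 -> p = q.
  by rewrite -!scaler_nat; apply: scalerI; rewrite pnatr_eq0.
(* Burgers up to order [j]: the Laplacian of [Q ^+ 2] is [2 <Q, Q>], and its coefficients are known
   by induction. *)
have burgers i : (i <= j)%N -> (Q^`() *+ 2)`_i = (grad2 a D Q Q)`_i.
  move=> leij; have ltiM : (i.+1 < M)%N by exact: leq_ltn_trans ltjM.
  apply: (@mulIrn _ _ 1).
  have := laplX a_sym D_mul 0 Q0.
  rewrite expr0 mul1r => /(congr1 (fun p : B => p`_i)).
  rewrite coef_lapl (IHj i) // 1?ltnW // linearZ /= coefMn => <-.
  rewrite coefMn coef_deriv coef_poly ltiM laplace_lpow.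
  by rewrite -(lpow_coefS 1 i) -scalerMnl -!mulrnA; congr (_ *+ _); lia.
(* The factor collects 2 from Burgers, [j.+1] from the [t]-derivative and [k.+2] from the Laplacian
   of the power. *)
apply: (@mulIrn _ _ (2 * j.+1 * k.+2).-1); rewrite prednK //.
have := congr1 (fun p : B => p`_j) (laplX a_sym D_mul k Q0).
rewrite coef_lapl (IHj j) // 1?ltnW // linearZ /= laplace_lpow -lpow_coefS.
rewrite -scalerMnl => ->; rewrite coefMn.
have -> : (Q ^+ k * grad2 a D Q Q)`_j = (Q ^+ k * (Q^`() *+ 2))`_j.
  by rewrite !coefM; apply: eq_bigr => i _; rewrite burgers // leq_subr.
have := congr1 (fun p : B => p`_j) (deriv_exp Q k.+1).
rewrite coef_deriv coefMn /= [_^`() * _]mulrC => derivQ.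
have -> : (2 * j.+1 * k.+2 = j.+1 * (2 * k.+2))%N by lia.
by rewrite mulrnA derivQ mulrnAr coefMn -!mulrnA; congr (_ *+ _); lia.
Qed.

(** The [t^m] coefficient of [Q ^+ 2] is a multiple of [lpow 2 m], which two Laplacians turn into
    [lpow 0 m.+2 = 0]. *)
Lemma laplace2_sum_lpow m :
  \sum_(i < m.+1) lpow_coef 1 i * lpow_coef 1 (m - i) *:
    iter 2 (laplace A) (lpow 1 i * lpow 1 (m - i)) = 0.
Proof.
have := coef_lpow_seriesX 1 (ltnSn m).
rewrite expr2 coefM => /(congr1 (iter 2 (laplace A))).
rewrite iter_laplaceZ iter_laplace_sum /= !laplace_lpow lpow0 scaler0 => sum0.
rewrite -[RHS]sum0.
apply: eq_bigr => -[i /= ltim] _; rewrite !coef_poly ltim ltnS leq_subr.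
by rewrite -scalerAl -scalerAr scalerA !linearZ.
Qed.


End GeneratingFunction.

(** * Isotropy from the middle term of the [t^(2m)] coefficient *)

Theorem corollary4p11 (R : realType) (n d : nat) (A : 'M[R[i]]_n)
    (P : {mpoly R[i][n]})
    (A_sym : A^T = A) (A_inv : A \in unitmx)
    (d_ge3 : (3 <= d)%N) (P_homog : P \is d.-homog)
    (P_nil : laplace_nilpotent A P) :
  (forall m : nat, (1 <= m)%N ->
     diff_form A (iter m (laplace A) (P ^+ m.+1))
                 (iter m (laplace A) (P ^+ m.+1)) = 0)
  /\ diff_form A P P = 0.
Proof.
suff isotropic m : diff_form A (lpow A P 1 m) (lpow A P 1 m) = 0.
  by split=> [m _|]; [exact: isotropic m | exact: isotropic 0].
pose deg i := (d * i.+1 - i.*2)%N.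
have lpow_homog i : lpow A P 1 i \is (deg i).-homog.
  by apply: iter_laplace_dhomog; apply: dhomogMn.
have lpow_harmonic i : laplace A (lpow A P 1 i) = 0.
  by rewrite laplace_lpow lpow0.
(* Consecutive degrees differ by [d - 2], which is positive since [d >= 3]. *)
have deg_lt i : (i < m)%N -> (deg i < deg m)%N.
  by rewrite /deg; nia.
have deg_ge2 : (2 <= deg m)%N by rewrite /deg; nia.
have := laplace2_sum_lpow A_sym P_nil m.*2.
(* Two Laplacians are already present, so [deg m] of them act in total. *)
move=> /(congr1 (iter (deg m - 2) (laplace A))).
rewrite iter_laplace0 iter_laplace_sum.
have ltm : (m < m.*2.+1)%N by lia.
rewrite (bigD1 (Ordinal ltm)) //=.
rewrite [X in _ + X]big1 => [|[i lti] /= ne_im]; last first.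
  rewrite iter_laplaceZ -[laplace A (laplace A _)]/(iter 2 (laplace A) _).
  (* Off the middle, one of [i] and [m.*2 - i] is below [m], so that factor has degree less than
     [deg m]. *)
  rewrite -iterD subnK //; have [ltim|leim] := ltnP i m.
    by rewrite (iter_laplace_harmonicM_eq0 _ _ _ (lpow_homog i)) ?scaler0 ?deg_lt.
  have {}ltim : (m.*2 - i < m)%N by move: ne_im; rewrite -val_eqE /=; lia.
  rewrite [lpow _ _ _ i * _]mulrC.
  rewrite (iter_laplace_harmonicM_eq0 _ _ _ (lpow_homog (m.*2 - i)%N)) //.
    by rewrite scaler0.
  exact: deg_lt.
rewrite addr0 iter_laplaceZ -[laplace A (laplace A _)]/(iter 2 (laplace A) _).
rewrite -iterD subnK // -addnn addnK iter_laplace_harmonicM //.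
(* At 0 the middle term is the form times a squared [lpow_coef], a factorial and a power of 2, all
   nonzero. *)
move=> /(congr1 (meval (fun=> 0))); rewrite meval0 mevalZ mevalMn.
rewrite (contraction_diff_form _ _ (lpow_homog m)) -mulrnA => /eqP.
have c0 := lpow_coef_neq0 R[i] 1 m.
rewrite mulf_eq0 (negPf (mulf_neq0 c0 c0)) mulrn_eq0 muln_eq0 expn_eq0 /=.
by rewrite orbF -[_`! == 0%N]negbK -lt0n fact_gt0 => /eqP.
Qed.
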